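(* For every $L\in\mathcal S$, the gradient of $J_{\rm innov}$ at $L$ with respect to the standard Euclidean (Frobenius) inner product on $\mathbb{R}^{n\times p}$ is $$\nabla_L J_{\rm innov}(L) = -2\,W_o(L)\,K(L).$$
   Context: System. $x_{t+1}=A x_t+w_t$, $y_{t+1}=Cx_{t+1}+v_{t+1}$, with $x_t\in\mathbb{R}^n$, $y_t\in\mathbb{R}^p$, $A\in\mathbb{R}^{n\times n}$, $C\in\mathbb{R}^{p\times n}$. The noises $(w_t)$ and $(v_t)$ are i.i.d. zero-mean sequences, independent of each other, with covariances $\mathbb{E}[w_tw_t^{\top}]=Q_w\succ 0$ and $\mathbb{E}[v_tv_t^{\top}]=R_v\succ0$; the initial state and initial estimate have finite second moments and are independent of the noises. Filter. For a gain $L\in\mathbb{R}^{n\times p}$: $\hat x_{t+1}^-=A\hat x_t$, $\delta_{t+1}=y_{t+1}-C\hat x_{t+1}^-$ (innovation), $\hat x_{t+1}=\hat x_{t+1}^-+L\delta_{t+1}$. The estimation error is $e_t=x_t-\hat x_t$. Notation. $F(L)=(I-LC)A$; $\mathcal S=\{L\in\mathbb{R}^{n\times p}: \rho(F(L))<1\}$, where $\rho$ is the spectral radius. For $L\in\mathcal S$ the following limits exist: $\Sigma_\delta(L)=\lim_{t\to\infty}\mathbb{E}[\delta_t\delta_t^{\top}]$ and $K(L)=\lim_{t\to\infty}\mathbb{E}[e_t\delta_t^{\top}]$. The innovations loss is $J_{\rm innov}:\mathcal S\to\mathbb{R}$, $J_{\rm innov}(L)=\operatorname{Tr}(\Sigma_\delta(L))$.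 For $L\in\mathcal S$, $W_o(L)$ is the observability Gramian of $(F(L),CA)$, i.e. the unique positive semidefinite solution of $W_o(L)=F(L)^{\top}W_o(L)F(L)+A^{\top}C^{\top}CA$. The gradient $\nabla_L J(L)$ is the matrix with $\operatorname{Tr}(\nabla_L J(L)^{\top}V)=dJ(L)\cdot V$ for all $V\in\mathbb{R}^{n\times p}$. *)

(* Defs.v *)
From HB Require Import structures.
From mathcomp Require Import all_boot all_order all_algebra.
From mathcomp Require Import all_classical all_reals all_analysis.
From mathcomp.real_closed Require Import complex.
Set Implicit Arguments.
Unset Strict Implicit.
Unset Printing Implicit Defensive.
Import Order.TTheory GRing.Theory Num.Theory.
Import numFieldNormedType.Exports.
Local Open Scope classical_set_scope.
Local Open Scope ring_scope.

Definition posdefmx {R : realType} {m : nat} (M : 'M[R]_m) : Prop :=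
  M^T = M /\ forall u : 'cV[R]_m, u != 0 -> 0 < (u^T *m M *m u) 0 0.

Definition possemidefmx {R : realType} {m : nat} (M : 'M[R]_m) : Prop :=
  M^T = M /\ forall u : 'cV[R]_m, 0 <= (u^T *m M *m u) 0 0.

(* The eigenvalues are the complex ones, as they must be for a real matrix. *)
Definition spectral_radius {R : realType} {m : nat} (M : 'M[R]_m) : R :=
  sup [set Normc.normc z |
       z in [set z : R[i] | eigenvalue (map_mx (real_complex R) M) z]].

Definition borel {R : realType} {m : nat} : set_system 'cV[R]_m :=
  <<s [set U : set 'cV[R]_m | open U] >>.

Definition random_vector {d : measure_display} {T : measurableType d}
    {R : realType} {m : nat} (X : T -> 'cV[R]_m) : Prop :=
  forall B, borel B -> measurable (X @^-1` B).

(* E[X Y^T].  The entries are expectations in \bar R; [fine] loses nothing when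
   X and Y have finite second moments. *)
Definition cross_moment {d : measure_display} {T : measurableType d}
    {R : realType} (P : probability T R) {m q : nat}
    (X : T -> 'cV[R]_m) (Y : T -> 'cV[R]_q) : 'M[R]_(m, q) :=
  \matrix_(i, j) fine 'E_P[(fun o => X o i 0 * Y o j 0)%R]%E.

Definition mean {d : measure_display} {T : measurableType d}
    {R : realType} (P : probability T R) {m : nat}
    (X : T -> 'cV[R]_m) : 'cV[R]_m :=
  \col_i fine 'E_P[(fun o => X o i 0)%R]%E.

Definition finite_second_moment {d : measure_display} {T : measurableType d}
    {R : realType} (P : probability T R) {m : nat}
    (X : T -> 'cV[R]_m) : Prop :=
  forall i, ('E_P[(fun o => X o i 0 ^+ 2)%R] < +oo)%E.

Definition sigma_vector {T : Type} {R : realType} {m : nat}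
    (X : T -> 'cV[R]_m) : set_system T :=
  [set X @^-1` B | B in borel].

Definition sigma_process {T : Type} {R : realType} {m : nat}
    (X : nat -> T -> 'cV[R]_m) : set_system T :=
  <<s \bigcup_t sigma_vector (X t) >>.

Definition independent_algebras {d : measure_display} {T : measurableType d}
    {R : realType} (P : probability T R) (G H : set_system T) : Prop :=
  forall E F, G E -> H F -> P (E `&` F) = (P E * P F)%E.

Definition mutually_independent {d : measure_display} {T : measurableType d}
    {R : realType} (P : probability T R) {m : nat}
    (X : nat -> T -> 'cV[R]_m) : Prop :=
  forall (s : seq nat) (B : nat -> set 'cV[R]_m),
    uniq s -> (forall t, borel (B t)) ->
    P (\bigcap_(t in [set` s]) (X t @^-1` B t)) =
    (\prod_(t <- s) P (X t @^-1` B t))%E.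

Definition identically_distributed {d : measure_display}
    {T : measurableType d} {R : realType} (P : probability T R) {m : nat}
    (X : nat -> T -> 'cV[R]_m) : Prop :=
  forall s t B, borel B -> P (X s @^-1` B) = P (X t @^-1` B).

Definition iid {d : measure_display} {T : measurableType d}
    {R : realType} (P : probability T R) {m : nat}
    (X : nat -> T -> 'cV[R]_m) : Prop :=
  [/\ forall t, random_vector (X t), mutually_independent P X
    & identically_distributed P X].

(* i.i.d., zero mean, covariance [Q] *)
Definition noise {d : measure_display} {T : measurableType d}
    {R : realType} (P : probability T R) {m : nat}
    (X : nat -> T -> 'cV[R]_m) (Q : 'M[R]_m) : Prop :=
  [/\ iid P X, forall t, finite_second_moment P (X t),
      forall t, mean P (X t) = 0
    & forall t, cross_moment P (X t) (X t) = Q].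

Fixpoint state {T : Type} {R : realType} {n : nat} (A : 'M[R]_n)
    (x0 : T -> 'cV[R]_n) (w : nat -> T -> 'cV[R]_n) (t : nat) :
    T -> 'cV[R]_n :=
  if t is s.+1 then fun o => A *m state A x0 w s o + w s o else x0.

(* Only the outputs y_t with t >= 1 are used below. *)
Definition output {T : Type} {R : realType} {n p : nat} (A : 'M[R]_n)
    (C : 'M[R]_(p, n)) (x0 : T -> 'cV[R]_n) (w : nat -> T -> 'cV[R]_n)
    (v : nat -> T -> 'cV[R]_p) (t : nat) : T -> 'cV[R]_p :=
  fun o => C *m state A x0 w t o + v t o.

Fixpoint estimate {T : Type} {R : realType} {n p : nat} (A : 'M[R]_n)
    (C : 'M[R]_(p, n)) (xhat0 : T -> 'cV[R]_n) (y : nat -> T -> 'cV[R]_p)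
    (L : 'M[R]_(n, p)) (t : nat) : T -> 'cV[R]_n :=
  if t is s.+1 then
    fun o => let xpred := A *m estimate A C xhat0 y L s o in
             xpred + L *m (y s.+1 o - C *m xpred)
  else xhat0.

(* Index shift: this is delta_{t+1} (there is no innovation at time 0). *)
Definition innovation_succ {T : Type} {R : realType} {n p : nat}
    (A : 'M[R]_n) (C : 'M[R]_(p, n)) (x0 xhat0 : T -> 'cV[R]_n)
    (w : nat -> T -> 'cV[R]_n) (v : nat -> T -> 'cV[R]_p)
    (L : 'M[R]_(n, p)) (t : nat) : T -> 'cV[R]_p :=
  let y := output A C x0 w v in
  fun o => y t.+1 o - C *m (A *m estimate A C xhat0 y L t o).

Definition estimation_error {T : Type} {R : realType} {n p : nat}
    (A : 'M[R]_n) (C : 'M[R]_(p, n)) (x0 xhat0 : T -> 'cV[R]_n)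
    (w : nat -> T -> 'cV[R]_n) (v : nat -> T -> 'cV[R]_p)
    (L : 'M[R]_(n, p)) (t : nat) : T -> 'cV[R]_n :=
  fun o => state A x0 w t o - estimate A C xhat0 (output A C x0 w v) L t o.

Definition closed_loop {R : realType} {n p : nat} (A : 'M[R]_n)
    (C : 'M[R]_(p, n)) (L : 'M[R]_(n, p)) : 'M[R]_n :=
  (1%:M - L *m C) *m A.

Definition stabilizing {R : realType} {n p : nat} (A : 'M[R]_n)
    (C : 'M[R]_(p, n)) : set 'M[R]_(n, p) :=
  [set L | spectral_radius (closed_loop A C L) < 1].

Definition Sigma_delta {d : measure_display} {T : measurableType d}
    {R : realType} (P : probability T R) {n p : nat}
    (A : 'M[R]_n) (C : 'M[R]_(p, n)) (x0 xhat0 : T -> 'cV[R]_n)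
    (w : nat -> T -> 'cV[R]_n) (v : nat -> T -> 'cV[R]_p)
    (L : 'M[R]_(n, p)) : 'M[R]_p :=
  let delta := innovation_succ A C x0 xhat0 w v L in
  lim ((fun t => cross_moment P (delta t) (delta t)) @ \oo).

Definition K_innov {d : measure_display} {T : measurableType d}
    {R : realType} (P : probability T R) {n p : nat}
    (A : 'M[R]_n) (C : 'M[R]_(p, n)) (x0 xhat0 : T -> 'cV[R]_n)
    (w : nat -> T -> 'cV[R]_n) (v : nat -> T -> 'cV[R]_p)
    (L : 'M[R]_(n, p)) : 'M[R]_(n, p) :=
  let e := estimation_error A C x0 xhat0 w v L in
  let delta := innovation_succ A C x0 xhat0 w v L in
  lim ((fun t => cross_moment P (e t.+1) (delta t)) @ \oo).

(* Meaningful on the open set [stabilizing A C]. *)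
Definition J_innov {d : measure_display} {T : measurableType d}
    {R : realType} (P : probability T R) {n p : nat}
    (A : 'M[R]_n) (C : 'M[R]_(p, n)) (x0 xhat0 : T -> 'cV[R]_n)
    (w : nat -> T -> 'cV[R]_n) (v : nat -> T -> 'cV[R]_p)
    (L : 'M[R]_(n, p)) : R :=
  \tr (Sigma_delta P A C x0 xhat0 w v L).

(* Observability Gramian of (F, H): the positive semidefinite solution of the
   discrete Lyapunov equation, unique when F has spectral radius < 1. *)
Definition observability_gramian {R : realType} {n p : nat} (F : 'M[R]_n)
    (H : 'M[R]_(p, n)) : 'M[R]_n :=
  xget 0 [set W | possemidefmx W /\ W = F^T *m W *m F + H^T *m H].

(* G is the gradient at L for the Frobenius inner product; differentiability
   is that of Frechet, on the normed space of n x p matrices. *)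
Definition is_gradient {R : realType} {n p : nat} (J : 'M[R]_(n, p) -> R)
    (L G : 'M[R]_(n, p)) : Prop :=
  differentiable J L /\ forall V, 'd J L V = \tr (G^T *m V).

(* Main.v *)
Require Import Defs.
From HB Require Import structures.
From mathcomp Require Import all_boot all_order all_algebra.
From mathcomp Require Import all_classical all_reals all_analysis.
From mathcomp Require Import measurable_realfun.
From mathcomp.real_closed Require Import complex.
From mathcomp Require Import ring lra.
Set Implicit Arguments.
Unset Strict Implicit.
Unset Printing Implicit Defensive.
Import Order.TTheory GRing.Theory Num.Theory.
Import numFieldNormedType.Exports.
Local Open Scope classical_set_scope.
Local Open Scope ring_scope.

(* Write F = (I - LC)A.  The error covariances obey the affine recursion
   X |-> Phi_L X = F X F^T + G(L); since rho(F) < 1 forces F^t -> 0, they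
   converge to its unique fixed point S(L).  The condition n |F^k| < 1 for some
   k is open in L and suffices for F^t -> 0, so the same holds near L, and S is
   continuous at L because k steps of Phi contract uniformly there.

   The gradient needs no derivative of S.  With W the Gramian at the fixed L,
   A^T C^T C A = W - F^T W F, and moving F to the other side of the trace,
     J(L + V) - J(L) = tr W (Phi_(L+V) - Phi_L)(S(L + V))
                     = tr (-2 W M + W V N) V^T,
   where M and N are the cross and innovation covariances evaluated at S(L + V);
   as V -> 0, M tends to K(L) and W V N to 0. *)

(** * Limits of sequences and matrices *)

Section sequences.
Variable R : realType.

Lemma contraction_cvg0 (q : R) (a b : nat -> R) :
  0 <= q < 1 -> (forall t, 0 <= a t) ->
  (forall t, a t.+1 <= q * a t + b t) -> b @ \oo --> 0 -> a @ \oo --> 0.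
Proof.
move=> /andP[q0 q1] a0 ab b0; apply/cvgr0Pnorm_le => e e0.
(* Once [b] stays below (1 - q) e / 2, the bounding map x |-> q x + (1 - q) e / 2 has fixed point e
   / 2, and the excess over it decays like q^j. *)
have d0 : 0 < (1 - q) * (e / 2) by rewrite mulr_gt0 ?divr_gt0 ?subr_gt0.
have /cvgr0Pnorm_le/(_ _ d0) [N _ bN] := b0.
have aN j : a (j + N)%N <= q ^+ j * a N + e / 2.
  elim: j => [|j IH]; first by rewrite expr0 mul1r add0n lerDl divr_ge0 ?ltW.
  rewrite addSn (le_trans (ab _))//.
  have bj : b (j + N)%N <= (1 - q) * (e / 2).
    by rewrite (le_trans (ler_norm _))// bN//= leq_addl.
  have := ler_wpM2l q0 IH; rewrite exprS; lra.
have : (fun j => q ^+ j * a N) @ \oo --> 0.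
  rewrite -[X in _ --> X](mul0r (a N)); apply: cvgMr_tmp.
  by apply: cvg_expr; rewrite ger0_norm.
have e20 : 0 < e / 2 by rewrite divr_gt0.
move=> /cvgr0Pnorm_le/(_ _ e20) [M _ qM].
exists (M + N)%N => //= t /= MNt.
have Nt : (N <= t)%N by rewrite (leq_trans _ MNt)// leq_addl.
rewrite ger0_norm// -(subnK Nt) (le_trans (aN _))//.
have := qM (t - N)%N; rewrite /= leq_subRL// addnC => /(_ MNt).
move=> /(le_trans (ler_norm _)); lra.
Qed.

(** Writing t = m k + r with r < k gives a t <= q^m a r, and the sum of [a] over the residues bounds
    every a r at once. *)
Lemma periodic_contraction_cvg0 (k : nat) (q : R) (a : nat -> R) :
  (0 < k)%N -> 0 <= q < 1 -> (forall t, 0 <= a t) ->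
  (forall t, a (t + k)%N <= q * a t) -> a @ \oo --> 0.
Proof.
move=> k0 /andP[q0 q1] a0 ak.
pose S := \sum_(r < k) a r.
have aq m r : a (m * k + r)%N <= q ^+ m * a r.
  elim: m => [|m IH]; first by rewrite expr0 mul1r mul0n.
  by rewrite mulSn -addnA addnC (le_trans (ak _))// exprS -mulrA ler_wpM2l.
have aS t : a t <= q ^+ (t %/ k) * S.
  rewrite [in a t](divn_eq t k) (le_trans (aq _ _))// ler_wpM2l ?exprn_ge0//.
  rewrite /S (bigD1 (Ordinal (ltn_pmod t k0)))//= lerDl sumr_ge0//.
apply: (@squeeze_cvgr _ _ _ _ (cst 0) (fun t => q ^+ (t %/ k) * S)).
- by near=> t; rewrite /= a0 aS.
- exact: cvg_cst.
- rewrite -[X in _ --> X](mul0r S); apply: cvgMr_tmp.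
  apply: (@cvg_comp _ _ _ (fun t => t %/ k)%N (GRing.exp q) _ \oo).
    exact: cvg_divnr.
  by apply: cvg_expr; rewrite ger0_norm.
Unshelve. all: by end_near. Qed.

End sequences.

Section matrix_limits.
Variable R : realType.

Lemma mx_entry_le m n (M : 'M[R]_(m, n)) i j : `|M i j| <= `|M|.
Proof.
rewrite [`|M|]/Num.norm/= mx_normrE.
exact: (le_bigmax 0 (fun ij : 'I_m * 'I_n => `|M ij.1 ij.2|) (i, j)).
Qed.

Lemma mx_norm_le m n (M : 'M[R]_(m, n)) e :
  0 <= e -> (forall i j, `|M i j| <= e) -> `|M| <= e.
Proof.
move=> e0 Me; rewrite [`|M|]/Num.norm/= mx_normrE.
by apply/bigmax_leP; split => // -[i j] _ /=.
Qed.

(** The norm is the largest absolute value of an entry and is submultiplicative only up to the inner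
    dimension; hence the factor [n%:R] in every contraction condition below. *)
Lemma mx_norm_mulmx m n p (M : 'M[R]_(m, n)) (N : 'M[R]_(n, p)) :
  `|M *m N| <= n%:R * `|M| * `|N|.
Proof.
apply: mx_norm_le => [|i j]; first by rewrite !mulr_ge0.
rewrite mxE (le_trans (ler_norm_sum _ _ _))//.
have -> : n%:R * `|M| * `|N| = \sum_(k < n) `|M| * `|N|.
  by rewrite sumr_const card_ord -mulrA mulr_natl.
by apply: ler_sum => k _; rewrite normrM ler_pM ?mx_entry_le.
Qed.

Lemma mx_norm_tr m n (M : 'M[R]_(m, n)) : `|M^T| = `|M|.
Proof.
apply/eqP; rewrite eq_le; apply/andP; split; apply: mx_norm_le => // i j.
  by rewrite mxE mx_entry_le.
by have := mx_entry_le M^T j i; rewrite mxE.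
Qed.

Lemma norm_mxtrace_mulmx m n (M : 'M[R]_(m, n)) (N : 'M[R]_(n, m)) :
  `|\tr (M *m N)| <= m%:R * n%:R * `|M| * `|N|.
Proof.
rewrite /mxtrace (le_trans (ler_norm_sum _ _ _))//.
have -> : m%:R * n%:R * `|M| * `|N| = \sum_(k < m) n%:R * `|M| * `|N|.
  by rewrite sumr_const card_ord -!mulrA mulr_natl.
apply: ler_sum => k _.
by rewrite (le_trans (mx_entry_le _ _ _))// mx_norm_mulmx.
Qed.

Section filter.
Context {T : Type} {F : set_system T} {FF : Filter F}.

(** The filter is arbitrary so that these limit lemmas serve both t tending to infinity and gains
    tending to L. *)
Lemma cvg_mxP m n (f : T -> 'M[R]_(m, n)) (l : 'M[R]_(m, n)) :
  f @ F --> l <-> forall i j, (fun x => f x i j) @ F --> l i j.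
Proof.
split=> [fl i j|fl].
  exact: (cvg_comp _ _ fl (@coord_continuous R m n i j l)).
apply/cvgrPdist_le => e e0.
have : \forall x \near F, forall i j, `|l i j - f x i j| <= e.
  apply: filter_forall => i; apply: filter_forall => j.
  by have /cvgrPdist_le/(_ _ e0) := fl i j.
apply: filterS => x xe; apply: mx_norm_le; rewrite ?ltW// => i j.
by rewrite !mxE.
Qed.

Lemma cvg_mulmx m n p (f : T -> 'M[R]_(m, n)) (g : T -> 'M[R]_(n, p))
    (M : 'M[R]_(m, n)) (N : 'M[R]_(n, p)) :
  f @ F --> M -> g @ F --> N -> (fun x => f x *m g x) @ F --> M *m N.
Proof.
move=> /cvg_mxP fM /cvg_mxP gN; apply/cvg_mxP => i j.
rewrite mxE; under eq_fun do rewrite mxE.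
apply: cvg_big => [|k _]; [exact: add_continuous|exact: cvgM].
Qed.

Lemma cvg_trmx m n (f : T -> 'M[R]_(m, n)) (M : 'M[R]_(m, n)) :
  f @ F --> M -> (fun x => (f x)^T) @ F --> M^T.
Proof.
move=> /cvg_mxP fM; apply/cvg_mxP => i j.
by rewrite mxE; under eq_fun do rewrite mxE; exact: fM.
Qed.

Lemma cvg_mxtrace n (f : T -> 'M[R]_n) (M : 'M[R]_n) :
  f @ F --> M -> (fun x => \tr (f x)) @ F --> \tr M.
Proof.
by move=> /cvg_mxP fM; apply: cvg_big => [|k _ //]; exact: add_continuous.
Qed.

Lemma cvg_expmx n (f : T -> 'M[R]_n) (M : 'M[R]_n) k :
  f @ F --> M -> (fun x => f x ^+ k : 'M[R]_n) @ F --> (M ^+ k : 'M[R]_n).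
Proof.
move=> fM; elim: k => [|k IH].
  by rewrite expr0; under eq_fun do rewrite expr0; exact: cvg_cst.
by rewrite exprS; under eq_fun do rewrite exprS; exact: cvg_mulmx.
Qed.

End filter.

Lemma mx_norm_exprD n (M : 'M[R]_n) s t :
  `|M ^+ (s + t)| <= n%:R * `|M ^+ t| * `|M ^+ s|.
Proof. by rewrite addnC exprD; exact: mx_norm_mulmx. Qed.

(** The norms of the powers shrink by the factor n |M^k| every k steps. *)
Lemma expmx_cvg0 n (M : 'M[R]_n) k :
  (0 < k)%N -> n%:R * `|M ^+ k| < 1 ->
  (fun t => M ^+ t : 'M[R]_n) @ \oo --> (0 : 'M[R]_n).
Proof.
move=> k0 Mk; apply/norm_cvg0P.
apply: (@periodic_contraction_cvg0 R k (n%:R * `|M ^+ k|)) => //.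
  by rewrite mulr_ge0.
by move=> t; exact: mx_norm_exprD.
Qed.

(** Turns a limit into a strict inequality on a single power, a condition that survives a small
    perturbation of M. *)
Lemma expmx_cvg0_small n (M : 'M[R]_n) :
  (fun t => M ^+ t : 'M[R]_n) @ \oo --> (0 : 'M[R]_n) ->
  exists2 k, (0 < k)%N & n%:R * `|M ^+ k| < 1.
Proof.
move=> /norm_cvg0P M0.
have : (fun t => n%:R * `|M ^+ t|) @ \oo --> (0 : R).
  by rewrite -[X in _ --> X](mulr0 n%:R); exact: cvgMl_tmp.
move=> /cvgr0Pnorm_lt/(_ _ ltr01) [N _ NP]; exists N.+1 => //.
by rewrite (le_lt_trans (ler_norm _))// NP/=.
Qed.

End matrix_limits.

(** * Powers of a matrix of spectral radius less than 1 *)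

Section spectral_radius.
Variable R : realType.

Lemma normc_ge0 (z : R[i]) : 0 <= Normc.normc z.
Proof. by case: z => x y; rewrite /Normc.normc sqrtr_ge0. Qed.

(** A supremum is an upper bound only of a set that is bounded above. Eigenvalues are among the
    finitely many roots of the characteristic polynomial, so the sum of the moduli of these roots is
    a bound. *)
Lemma normc_eigenvalue_le n (M : 'M[R]_n) (z : R[i]) :
  eigenvalue (map_mx (real_complex R) M) z ->
  Normc.normc z <= spectral_radius M.
Proof.
move=> Mz; apply: ub_le_sup; last by exists z.
have [s Es] := closed_field_poly_normal (char_poly (map_mx (real_complex R) M)).
exists (\sum_(x <- s) Normc.normc x) => _ [x Mx <-].
have xs : x \in s.
  move: Mx; rewrite /= eigenvalue_root_char Es rootZ ?root_prod_XsubC//.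
  by rewrite lead_coef_eq0 monic_neq0// char_poly_monic.
rewrite (big_rem x)//= lerDl sumr_ge0// => y _; exact: normc_ge0.
Qed.

(* With B_s t = M^t prod_(z in s) (M - z), the recurrence
   B_s (t+1) = z B_s t + B_(z :: s) t peels one eigenvalue at a time off the
   factorized characteristic polynomial, which kills M by Cayley-Hamilton. *)
Lemma normc_expmx_cvg0 n (M : 'M[R[i]]_n.+1) (q : R) :
  (forall z, eigenvalue M z -> Normc.normc z <= q) -> 0 <= q < 1 ->
  forall i j, (fun t => Normc.normc ((M ^+ t) i j)) @ \oo --> 0.
Proof.
move=> Mq q01.
have [s Es] := closed_field_poly_normal (char_poly M).
move: Es; rewrite (monicP (char_poly_monic M)) scale1r => Es.
have sq z : z \in s -> Normc.normc z <= q.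
  by move=> zs; apply: Mq; rewrite eigenvalue_root_char Es root_prod_XsubC.
pose B (r : seq R[i]) := horner_mx M (\prod_(z <- r) ('X - z%:P)).
have B0 i j : (fun t => Normc.normc ((M ^+ t * B s) i j)) @ \oo --> 0.
  rewrite /B -Es Cayley_Hamilton.
  under eq_fun do rewrite mulr0 mxE Normc.normc0.
  exact: cvg_cst.
suff H i j : (fun t => Normc.normc ((M ^+ t * B [::]) i j)) @ \oo --> 0.
  move=> i j; have := H i j; rewrite /B big_nil rmorph1.
  by under eq_fun do rewrite mulr1.
move: i j.
elim: s sq B0 {Es} => [//|z s IH] sq B0.
apply: IH => [x xs|i j]; first by rewrite sq// inE xs orbT.
have BS t : M ^+ t.+1 * B s = z%:M * (M ^+ t * B s) + M ^+ t * B (z :: s).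
  rewrite /B big_cons rmorphM rmorphB/= horner_mx_X horner_mx_C.
  have zC : M ^+ t * z%:M = z%:M * M ^+ t by exact: scalar_mxC.
  rewrite mulrBl mulrBr [M ^+ t * (z%:M * _)]mulrA zC -mulrA exprSr -mulrA.
  by rewrite addrC subrK.
apply: (contraction_cvg0 q01 _ _ (B0 i j)) => t; first exact: normc_ge0.
rewrite BS mxE (le_trans (le_normcD _ _))// lerD2r.
rewrite -mulmxE mul_scalar_mx mxE Normc.normcM ler_wpM2r ?normc_ge0//.
by rewrite sq// inE eqxx.
Qed.

Lemma spectral_radius_lt1_cvg0 n (M : 'M[R]_n) :
  spectral_radius M < 1 -> (fun t => M ^+ t : 'M[R]_n) @ \oo --> (0 : 'M[R]_n).
Proof.
(* An empty matrix has no entries to check; otherwise the dimension is a successor, as in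
   [normc_expmx_cvg0]. *)
case: n M => [|n] M Mlt1.
  by apply/cvg_mxP => -[].
apply/cvg_mxP => i j; rewrite mxE; apply/norm_cvg0P.
(* The maximum with 0 makes the ratio nonnegative without exhibiting an eigenvalue. *)
pose q := Num.max 0 (spectral_radius M).
have q01 : 0 <= q < 1 by rewrite le_max lexx gt_max ltr01.
have Mq z : eigenvalue (map_mx (real_complex R) M) z -> Normc.normc z <= q.
  by move=> Mz; rewrite le_max (normc_eigenvalue_le Mz) orbT.
have MC t : `|(M ^+ t) i j| =
    Normc.normc ((map_mx (real_complex R) M ^+ t) i j).
  by rewrite -rmorphXn/= mxE /Normc.normc/= expr0n/= addr0 sqrtr_sqr.
under eq_fun do rewrite MC.
exact: normc_expmx_cvg0 Mq q01 i j.
Qed.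

End spectral_radius.

(** * The discrete Lyapunov equation *)

Section stein.
Context {R : realType} {n : nat}.
Implicit Types F G X Y : 'M[R]_n.

(** One step of the covariance recursion of x |-> F x + noise, with G the noise covariance; its
    fixed points solve the discrete Lyapunov (Stein) equation. *)
Definition stein F G X : 'M[R]_n := F *m X *m F^T + G.

Lemma trmx_expmx F t : (F ^+ t)^T = F^T ^+ t.
Proof.
elim: t => [|t IH]; first by rewrite !expr0 trmx1.
by rewrite exprS exprSr -IH -mulmxE trmx_mul.
Qed.

Lemma iter_stein_sub F G X Y t :
  iter t (stein F G) X - iter t (stein F G) Y
  = F ^+ t *m (X - Y) *m (F ^+ t)^T.
Proof.
elim: t => [|t IH]; first by rewrite expr0 trmx1 mul1mx mulmx1.
rewrite !iterS /stein opprD addrACA subrr addr0.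
by rewrite -mulmxBl -mulmxBr IH exprS -mulmxE trmx_mul !mulmxA.
Qed.

Lemma stein_cvg0 F (X : 'M[R]_n) :
  (fun t => F ^+ t : 'M[R]_n) @ \oo --> (0 : 'M[R]_n) ->
  (fun t => F ^+ t *m X *m (F ^+ t)^T) @ \oo --> (0 : 'M[R]_n).
Proof.
move=> F0; rewrite -[X in _ --> X](mul0mx n (0 : 'M[R]_n)^T).
apply: cvg_mulmx; last exact: cvg_trmx.
by rewrite -[X in _ --> X](mul0mx n X); apply: cvg_mulmx => //; exact: cvg_cst.
Qed.

(** Two fixed points have constant orbits, yet the difference of their orbits, F^t (X - Y) (F^t)^T,
    tends to 0. *)
Lemma stein_unique F G X Y :
  (fun t => F ^+ t : 'M[R]_n) @ \oo --> (0 : 'M[R]_n) ->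
  X = stein F G X -> Y = stein F G Y -> X = Y.
Proof.
move=> F0 XE YE; apply/subr0_eq.
have iterE Z t : Z = stein F G Z -> iter t (stein F G) Z = Z.
  by move=> ZE; elim: t => // t IH; rewrite iterS IH -ZE.
have := stein_cvg0 (X - Y) F0.
under eq_fun => t do rewrite -(iter_stein_sub F G) !iterE//.
by move=> /(cvg_unique _ (cvg_cst _)); apply.
Qed.

(** X |-> X - F X F^T is an endomorphism of a finite-dimensional space; uniqueness makes it
    injective, hence surjective, and G has a preimage. *)
Lemma stein_exists F G :
  (fun t => F ^+ t : 'M[R]_n) @ \oo --> (0 : 'M[R]_n) ->
  exists X, X = stein F G X.
Proof.
move=> F0.
pose f := (\1 - linfun (mulmxr F^T \o mulmx F))%VF : 'End('M[R]_n).
have fE X : f X = X - F *m X *m F^T.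
  by rewrite /f add_lfunE opp_lfunE id_lfunE lfunE.
have kf : lker f == 0%VS.
  apply/lker0P => X Y; rewrite !fE => /eqP; rewrite subr_eq => /eqP XE.
  apply: (@stein_unique F (Y - F *m Y *m F^T) X Y F0).
    by rewrite /stein addrC.
  by rewrite /stein addrC subrK.
have : G \in limg f by rewrite lker0_limgf// memvf.
move=> /memv_imgP[X _]; rewrite fE => GE; exists X.
by rewrite /stein GE addrC subrK.
Qed.

Lemma iter_stein_cvg F G X Y :
  (fun t => F ^+ t : 'M[R]_n) @ \oo --> (0 : 'M[R]_n) ->
  Y = stein F G Y -> (fun t => iter t (stein F G) X) @ \oo --> Y.
Proof.
move=> F0 YE.
have iterE t : iter t (stein F G) Y = Y.
  by elim: t => // t IH; rewrite iterS IH -YE.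
apply/subr_cvg0.
have := stein_cvg0 (X - Y) F0.
by under eq_fun => t do rewrite -(iter_stein_sub F G) iterE.
Qed.

Lemma mx_norm_congr k F X :
  `|F ^+ k *m X *m (F ^+ k)^T| <= (n%:R * `|F ^+ k|) ^+ 2 * `|X|.
Proof.
rewrite (le_trans (mx_norm_mulmx _ _))// mx_norm_tr.
rewrite mulrAC expr2 -[leRHS]mulrA.
by rewrite ler_wpM2l ?mulr_ge0// mx_norm_mulmx.
Qed.

(** The Gramian is chosen with default 0, so its equation is available only once some positive
    semidefinite solution is exhibited. The fixed point for F^T is one; it is symmetric because its
    transpose solves the same equation. *)
Lemma observability_gramian_stein p F (H : 'M[R]_(p, n)) :
  (fun t => F ^+ t : 'M[R]_n) @ \oo --> (0 : 'M[R]_n) ->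
  let W := observability_gramian F H in
  W^T = W /\ W = F^T *m W *m F + H^T *m H.
Proof.
move=> F0; rewrite /observability_gramian; case: xgetP => [W _ [[WT _] WE] //|].
have FT0 : (fun t => F^T ^+ t : 'M[R]_n) @ \oo --> (0 : 'M[R]_n).
  rewrite -[X in _ --> X](trmx0 R n n); under eq_fun do rewrite -trmx_expmx.
  exact: cvg_trmx.
have [W WE] := stein_exists (H^T *m H) FT0.
move=> /(_ W); case; split; last by rewrite [LHS]WE /stein trmxK.
have iterE t : iter t (stein F^T (H^T *m H)) W = W.
  by elim: t => // t IH; rewrite iterS IH -WE.
split.
  apply: (stein_unique FT0 (G := H^T *m H)) => //.
  by rewrite [in LHS]WE /stein linearD/= !trmx_mul !trmxK mulmxA.
move=> u.
(* W dominates each (F^t)^T W F^t, which tends to 0. *)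
have Wge t : ((u^T *m (F^T ^+ t *m W *m (F^T ^+ t)^T)) *m u) 0 0
    <= (u^T *m W *m u) 0 0.
  (* The iterates from 0 are partial sums of terms of the form Z^T Z, hence nonnegative; W minus the
     t-th iterate is exactly (F^t)^T W F^t. *)
  have S0 s v : (v^T *m iter s (stein F^T (H^T *m H)) 0 *m v) 0 0 >= 0 :> R.
    elim: s v => [|s IH] v; first by rewrite mulmx0 mul0mx mxE.
    rewrite iterS; move: (iter _ _ _) IH => Y IH.
    rewrite /stein trmxK mulmxDr mulmxDl mxE addr_ge0//.
      by have := IH (F *m v); rewrite trmx_mul !mulmxA.
    rewrite mulmxA -trmx_mul -mulmxA mxE sumr_ge0// => i _.
    by rewrite mxE -expr2 sqr_ge0.
  have := iter_stein_sub F^T (H^T *m H) W 0 t.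
  rewrite iterE subr0 => <-; rewrite mulmxBr mulmxBl mxE [X in _ + X <= _]mxE.
  by rewrite -[X in _ <= X]subr0 lerD2l lerN2 S0.
have : (fun t => ((u^T *m (F^T ^+ t *m W *m (F^T ^+ t)^T)) *m u) 0 0) @ \oo
    --> (0 : R).
  have : (fun t => (u^T *m (F^T ^+ t *m W *m (F^T ^+ t)^T)) *m u) @ \oo
      --> (0 : 'M[R]_1).
    rewrite -[X in _ --> X](mul0mx 1 u); apply: cvg_mulmx; last exact: cvg_cst.
    rewrite -[X in _ --> X](mulmx0 _ u^T).
    apply: cvg_mulmx; first exact: cvg_cst.
    exact: stein_cvg0.
  by move=> /cvg_mxP/(_ 0 0); rewrite mxE.
move=> /cvgr_to_le; apply; near=> t; exact: Wge.
Unshelve. all: by end_near. Qed.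

End stein.

(** * The steady-state error covariance as a function of the gain *)

Section riccati.
Context {R : realType} {n p : nat}.
Variables (A : 'M[R]_n) (C : 'M[R]_(p, n)) (Qw : 'M[R]_n) (Rv : 'M[R]_p).
Implicit Types (L D : 'M[R]_(n, p)) (X : 'M[R]_n).

(** Covariance of the noise entering the error in one step, (I - L C) w_t - L v_{t+1}. *)
Definition drive L : 'M[R]_n :=
  (1%:M - L *m C) *m Qw *m (1%:M - L *m C)^T + L *m Rv *m L^T.

(** With X the covariance of e_t, this is the covariance of delta_{t+1}, and [error_innov_cov] is
    the cross moment of e_{t+1} and delta_{t+1}. *)
Definition innov_cov X : 'M[R]_p := C *m (A *m X *m A^T + Qw) *m C^T + Rv.

Definition error_innov_cov L X : 'M[R]_(n, p) :=
  (1%:M - L *m C) *m (A *m X *m A^T + Qw) *m C^T - L *m Rv.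

Definition err_step L X : 'M[R]_n := stein (closed_loop A C L) (drive L) X.

(** The Joseph form: everything passes through the predicted covariance A X A^T + Qw, and the
    quadratic dependence on the gain becomes visible. *)
Lemma err_stepE L X : err_step L X =
  (1%:M - L *m C) *m (A *m X *m A^T + Qw) *m (1%:M - L *m C)^T + L *m Rv *m L^T.
Proof.
rewrite /err_step /stein /drive /closed_loop trmx_mul addrA.
set B := 1%:M - L *m C; congr (_ + _).
by rewrite mulmxDr mulmxDl !mulmxA.
Qed.

Lemma err_stepD L D X : Qw^T = Qw -> Rv^T = Rv -> X^T = X ->
  err_step (L + D) X - err_step L X =
  - (D *m (error_innov_cov L X)^T + error_innov_cov L X *m D^T)
  + D *m innov_cov X *m D^T.
Proof.
move=> QT VT XT; rewrite !err_stepE /error_innov_cov /innov_cov.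
set S := A *m X *m A^T + Qw; set B := 1%:M - L *m C.
have ST : S^T = S by rewrite /S linearD/= !trmx_mul trmxK XT QT mulmxA.
have -> : 1%:M - (L + D) *m C = B - D *m C by rewrite mulmxDl opprD addrA.
clearbody S B.
rewrite !linearB !linearD/= !trmx_mul ST VT trmxK.
rewrite !(mulmxDl, mulmxDr, mulmxBl, mulmxBr, mulNmx, mulmxN) !mulmxA.
(* The products are frozen as atoms; an additive identity remains, checked entry by entry. *)
move: (B *m S *m B^T) (D *m C *m S *m B^T) (B *m S *m C^T *m D^T)
  (D *m C *m S *m C^T *m D^T) (L *m Rv *m L^T) (D *m Rv *m L^T)
  (L *m Rv *m D^T) (D *m Rv *m D^T) => M1 M2 M3 M4 M5 M6 M7 M8.
by apply/matrixP => i j; rewrite !mxE; ring.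
Qed.

(** Symmetry of W gives the two cross terms the same trace, whence the factor 2. Pulling D^T to the
    right exposes the Frobenius product with D. *)
Lemma tr_gramian_increment (W : 'M[R]_n) L D X :
  Qw^T = Qw -> Rv^T = Rv -> X^T = X -> W^T = W ->
  \tr (W *m (err_step (L + D) X - err_step L X))
  = \tr ((- 2 *: (W *m error_innov_cov L X) + W *m D *m innov_cov X) *m D^T).
Proof.
move=> QT VT XT WT; rewrite err_stepD//.
set M := error_innov_cov L X.
have trM : \tr (W *m (D *m M^T)) = \tr (W *m (M *m D^T)).
  by rewrite -mxtrace_tr !trmx_mul trmxK WT mxtrace_mulC.
clearbody M.
rewrite mulmxDr mulmxN mulmxDr mulmxDl !mxtraceD linearN/= mxtraceD trM.
by rewrite -scalemxAl mxtraceZ !mulmxA; ring.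
Qed.

Lemma trmx_drive L : Qw^T = Qw -> Rv^T = Rv -> (drive L)^T = drive L.
Proof.
by move=> QT VT; rewrite /drive linearD/= !trmx_mul !trmxK QT VT !mulmxA.
Qed.

Lemma trmx_err_step_fix L X : Qw^T = Qw -> Rv^T = Rv ->
  (fun t => closed_loop A C L ^+ t : 'M[R]_n) @ \oo --> (0 : 'M[R]_n) ->
  X = err_step L X -> X^T = X.
Proof.
move=> QT VT F0 XE; apply: (stein_unique F0 _ XE).
rewrite [in LHS]XE /err_step /stein linearD/= trmx_drive//; congr (_ + _).
by move: (closed_loop A C L) => F; rewrite !trmx_mul trmxK mulmxA.
Qed.

Lemma cvg_closed_loop T (F : set_system T) {FF : Filter F}
    (l : T -> 'M[R]_(n, p)) L :
  l @ F --> L -> (fun x => closed_loop A C (l x)) @ F --> closed_loop A C L.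
Proof.
move=> lL; apply: cvg_mulmx; last exact: cvg_cst.
apply: cvgB; first exact: cvg_cst.
by apply: cvg_mulmx => //; exact: cvg_cst.
Qed.

Lemma cvg_err_step T (F : set_system T) {FF : Filter F}
    (l : T -> 'M[R]_(n, p)) (f : T -> 'M[R]_n) L X :
  l @ F --> L -> f @ F --> X ->
  (fun x => err_step (l x) (f x)) @ F --> err_step L X.
Proof.
move=> lL fX; rewrite err_stepE; under eq_fun do rewrite err_stepE.
have BL : (fun x => 1%:M - l x *m C) @ F --> (1%:M - L *m C : 'M[R]_n).
  by apply: cvgB; [exact: cvg_cst|apply: cvg_mulmx => //; exact: cvg_cst].
apply: cvgD; apply: cvg_mulmx; [|exact: cvg_trmx| |exact: cvg_trmx].
  apply: cvg_mulmx => //; apply: cvgD; last exact: cvg_cst.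
  apply: cvg_mulmx; last exact: cvg_cst.
  by apply: cvg_mulmx => //; exact: cvg_cst.
by apply: cvg_mulmx => //; exact: cvg_cst.
Qed.

Lemma cvg_innov_cov T (F : set_system T) {FF : Filter F} (f : T -> 'M[R]_n) X :
  f @ F --> X -> innov_cov (f x) @[x --> F] --> innov_cov X.
Proof.
move=> fX; apply: cvgD; last exact: cvg_cst.
apply: cvg_mulmx; last exact: cvg_cst.
apply: cvg_mulmx; first exact: cvg_cst.
apply: cvgD; last exact: cvg_cst.
apply: cvg_mulmx; last exact: cvg_cst.
by apply: cvg_mulmx => //; exact: cvg_cst.
Qed.

Lemma cvg_error_innov_cov T (F : set_system T) {FF : Filter F}
    (f : T -> 'M[R]_n) L X :
  f @ F --> X -> error_innov_cov L (f x) @[x --> F] --> error_innov_cov L X.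
Proof.
move=> fX; apply: cvgB; last exact: cvg_cst.
apply: cvg_mulmx; last exact: cvg_cst.
apply: cvg_mulmx; first exact: cvg_cst.
apply: cvgD; last exact: cvg_cst.
apply: cvg_mulmx; last exact: cvg_cst.
by apply: cvg_mulmx => //; exact: cvg_cst.
Qed.

Lemma near_closed_loop_small L k (c : R) :
  n%:R * `|closed_loop A C L ^+ k| < c ->
  \forall L' \near L, n%:R * `|closed_loop A C L' ^+ k| < c.
Proof.
move=> Lc.
have /cvg_norm Lk : (closed_loop A C x ^+ k : 'M[R]_n) @[x --> L]
    --> (closed_loop A C L ^+ k : 'M[R]_n).
  exact: (cvg_expmx (cvg_closed_loop (@cvg_id _ (nbhs L)))).
exact: (cvgr_lt _ (cvgMl_tmp (a := n%:R) Lk) _ Lc).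
Qed.

Lemma near_closed_loop_cvg0 L :
  (fun t => closed_loop A C L ^+ t : 'M[R]_n) @ \oo --> (0 : 'M[R]_n) ->
  \forall L' \near L,
    (fun t => closed_loop A C L' ^+ t : 'M[R]_n) @ \oo --> (0 : 'M[R]_n).
Proof.
move=> /expmx_cvg0_small[k k0 Lk].
by apply: filterS (near_closed_loop_small Lk) => L'; exact: expmx_cvg0.
Qed.

(** The k-fold iterate started at the fixed matrix S L is continuous in the gain x. Since S x is its
    own iterate, it differs from that iterate by at most c^2 |S L - S x| with c < 1, and this term
    is absorbed on the left. *)
Lemma cvg_err_cov L (S : 'M[R]_(n, p) -> 'M[R]_n) :
  (fun t => closed_loop A C L ^+ t : 'M[R]_n) @ \oo --> (0 : 'M[R]_n) ->
  (\forall L' \near L, S L' = err_step L' (S L')) ->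
  S x @[x --> L] --> S L.
Proof.
move=> F0 SE.
have [k k0] := expmx_cvg0_small F0.
set a := n%:R * _ => a1.
(* A constant strictly between n |F^k| and 1 bounds n |F(x)^k| for all x near L, so the contraction
   is uniform there. *)
have [c ac c1] : exists2 c, a < c & c < 1.
  by exists ((a + 1) / 2); lra.
have a0 : 0 <= a by rewrite mulr_ge0.
have c21 : 0 < 1 - c ^+ 2 by rewrite subr_gt0 expr_lt1// (le_trans a0)// ltW.
have iterE L' : S L' = err_step L' (S L') -> iter k (err_step L') (S L') = S L'.
  by move=> LE; elim: k {k0 a a1 ac a0} => // k IH; rewrite iterS IH -LE.
have itL : iter k (err_step x) (S L) @[x --> L] --> iter k (err_step L) (S L).
  elim: (k) => [|m IH]; first exact: (@cvg_cst _ (S L) _ (nbhs L)).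
  exact: (cvg_err_step (@cvg_id _ (nbhs L)) IH).
rewrite (iterE L (nbhs_singleton SE)) in itL.
apply/(@cvgrPdist_le _ _ _ (nbhs L)) => e e0.
have /cvgrPdist_le/(_ _ (mulr_gt0 c21 e0)) itLe := itL.
near=> x.
have xE : S x = err_step x (S x) by near: x.
have xc : n%:R * `|closed_loop A C x ^+ k| < c.
  by near: x; exact: near_closed_loop_small.
have xe : `|S L - iter k (err_step x) (S L)| <= (1 - c ^+ 2) * e by near: x.
have dE : S L - S x = (S L - iter k (err_step x) (S L))
    + (iter k (err_step x) (S L) - iter k (err_step x) (S x)).
  by rewrite (iterE x xE) addrA subrK.
have : `|S L - S x| <= (1 - c ^+ 2) * e + c ^+ 2 * `|S L - S x|.
  rewrite {1}dE (le_trans (ler_normD _ _))// lerD// iter_stein_sub.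
  rewrite (le_trans (mx_norm_congr _ _ _))// ler_wpM2r//.
  rewrite lerXn2r ?nnegrE ?mulr_ge0//.
    by rewrite (le_trans a0)// ltW.
  exact: ltW.
rewrite -lerBlDr -[X in X - _]mul1r -mulrBl ler_pM2l//.
Unshelve. all: by end_near. Qed.

End riccati.

(** * A criterion for the Frobenius gradient *)

Section gradient.
Context {R : realType} {n p : nat}.

(** Named so that it can carry the linear structure needed to identify it with the differential. *)
Definition frobenius_form (G D : 'M[R]_(n, p)) : R := \tr (G^T *m D).

Fact frobenius_form_linear G : linear_for *:%R (frobenius_form G).
Proof.
move=> a X Y; rewrite /frobenius_form mulmxDr -scalemxAr mxtraceD mxtraceZ.
by [].
Qed.

HB.instance Definition _ G := GRing.isLinear.Build R 'M[R]_(n, p) R *:%R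
  (frobenius_form G) (frobenius_form_linear G).

(** Differentiability in the form of Caratheodory: the increment is an exact product with E, so the
    error of the linear approximation is tr (E - G) D^T, which is o(D) as soon as E tends to G. *)
Lemma is_gradient_increment (J : 'M[R]_(n, p) -> R) (L G : 'M[R]_(n, p))
    (E : 'M[R]_(n, p) -> 'M[R]_(n, p)) :
  (\forall L' \near L, J L' - J L = \tr (E L' *m (L' - L)^T)) ->
  E x @[x --> L] --> G -> is_gradient J L G.
Proof.
move=> JE EG.
have cf : continuous (frobenius_form G).
  move=> x.
  have Gx : (fun=> G^T) @ nbhs x --> G^T by exact: cvg_cst.
  exact: (cvg_mxtrace (cvg_mulmx Gx (@cvg_id _ (nbhs x)))).
have sL : D + L @[D --> (0 : 'M[R]_(n, p))] --> L.
  rewrite -[X in _ --> X]add0r.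
  have cL : (fun=> L) @ nbhs (0 : 'M[R]_(n, p)) --> L by exact: cvg_cst.
  exact: (cvgD (@cvg_id _ (nbhs (0 : 'M[R]_(n, p)))) cL).
have Jo : J \o shift L
    = cst (J L) + frobenius_form G +o_ (0 : 'M[R]_(n, p)) id.
  apply/eqaddoP => e e0.
  (* n p is the constant in the trace bound; adding 1 keeps the divisor positive in dimension 0. *)
  have np0 : 0 < n%:R * p%:R + 1 :> R by rewrite ltr_wpDl ?mulr_ge0.
  have /cvgrPdist_le/(_ _ (divr_gt0 e0 np0)) EGe := EG.
  near=> D.
  have DE : J (D + L) - J L = \tr (E (D + L) *m D^T).
    by rewrite -[in X in X^T](addrK L D); near: D; exact: sL JE.
  have De : `|G - E (D + L)| <= e / (n%:R * p%:R + 1).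
    by near: D; exact: sL EGe.
  rewrite /= !fctE /= /shift/= opprD addrA DE /frobenius_form.
  have -> : \tr (G^T *m D) = \tr (G *m D^T).
    by rewrite -mxtrace_tr trmx_mul trmxK mxtrace_mulC.
  rewrite -linearB/= -mulmxBl (le_trans (norm_mxtrace_mulmx _ _))// mx_norm_tr.
  rewrite ler_wpM2r// distrC (le_trans (ler_wpM2l _ De)) ?mulr_ge0//.
  by rewrite mulrA ler_pdivrMr// mulrDr mulr1 [e * _]mulrC lerDl ltW.
have dJ := diff_unique cf Jo.
split; first by apply/diff_locallyP; rewrite dJ.
by move=> D; rewrite dJ.
Unshelve. all: by end_near. Qed.

End gradient.

(** * Independence and second moments *)

Section independence.
Context {d : measure_display} {T : measurableType d} {R : realType}.
Variable P : probability T R.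

(** By independence the law of the pair agrees with the product of the laws on rectangles, hence
    everywhere; Fubini then splits the integral of x y. *)
Lemma expectation_mul_independent (X Y : {RV P >-> R}) :
  (X : T -> R) \in Lfun P 2%:E -> (Y : T -> R) \in Lfun P 2%:E ->
  (forall A B : set R, measurable A -> measurable B ->
    P (X @^-1` A `&` Y @^-1` B) = (P (X @^-1` A) * P (Y @^-1` B))%E) ->
  ('E_P[X \* Y] = 'E_P[X] * 'E_P[Y])%E.
Proof.
move=> X2 Y2 XY.
have P1 : P setT \is a fin_num by rewrite probability_setT.
have /Lfun1_integrable X1 := Lfun_subset12 P1 X2.
have /Lfun1_integrable Y1 := Lfun_subset12 P1 Y2.
have /Lfun1_integrable XY1 := Lfun2_mul_Lfun1 X2 Y2.
pose Z : T -> R * R := fun o => (X o, Y o).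
have mZ : measurable_fun setT Z by apply: measurable_fun_pair.
pose Zm := isMeasurableFun.Build _ _ _ _ Z mZ.
pose ZZ : {mfun T >-> (R * R)%type} := HB.pack Z Zm.
pose m1 := distribution P X; pose m2 := distribution P Y.
pose f (z : R * R) : \bar R := (z.1 * z.2)%:E.
have mf : measurable_fun [set: (R * R)%type] f.
  by apply/measurable_EFinP; apply: measurable_funM.
have ZE : (\int[distribution P ZZ]_z f z = \int[(m1 \x m2)%E]_z f z)%E.
  apply: eq_measure_integral => A mA _; apply/esym.
  by apply: product_measure_unique => // B C mB mC; exact: XY.
have iabs (U : {RV P >-> R}) : P.-integrable setT (EFin \o U) ->
    (\int[distribution P U]_x `|x%:E| < +oo)%E.
  move=> /integrableP[_ Uoo].
  rewrite ge0_integral_distribution//.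
  by apply: measurableT_comp => //; exact: measurable_EFinP.
(* Tonelli: the iterated integral of |x y| factors into two absolute first moments, both finite. *)
have f_int : (m1 \x m2)%E.-integrable setT f.
  apply/integrable12ltyP => //.
  have fE (x : R) : (\int[m2]_y `|f (x, y)| = `|x|%:E * \int[m2]_y `|y%:E|)%E.
    rewrite -ge0_integralZl_EFin//.
      by apply: eq_integral => y _; rewrite /f/= normrM EFinM.
    by apply: measurableT_comp => //; exact: measurable_EFinP.
  under eq_integral do rewrite fE.
  rewrite ge0_integralZr//; last 2 first.
  - by apply: measurableT_comp => //; exact: measurable_EFinP.
  - by rewrite integral_ge0.
  by rewrite lte_mul_pinfty ?integral_ge0 ?ge0_fin_numE ?iabs ?integral_ge0.
have idist (U : {RV P >-> R}) : P.-integrable setT (EFin \o U) ->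
    (distribution P U).-integrable setT (@EFin R).
  by move=> iU; apply: integrable_pushforward.
have Edist (U : {RV P >-> R}) : P.-integrable setT (EFin \o U) ->
    ('E_P[U] = \int[distribution P U]_x x%:E)%E.
  by move=> iU; rewrite integral_distribution// unlock.
have YE : ('E_P[Y] = (fine 'E_P[Y])%:E)%E.
  by rewrite fineK// expectation_fin_num//; exact/Lfun1_integrable.
transitivity (\int[distribution P ZZ]_z f z)%E.
  by rewrite integral_distribution// unlock.
rewrite ZE -integral12_prod_meas1// /fubini_F.
have fE (x : R) : (\int[m2]_y f (x, y) = x%:E * 'E_P[Y])%E.
  by rewrite Edist// -integralZl//; exact: idist.
under eq_integral do rewrite fE YE.
by rewrite integralZr//; [rewrite -YE -Edist|exact: idist].
Qed.

End independence.

Section moments.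
Context {d : measure_display} {T : measurableType d} {R : realType}.
Variable P : probability T R.

Let inner (f g : T -> R) : R := fine ('E_P[f \* g])%E.

Let ler12 : (1 <= 2%:E :> \bar R)%E.
Proof. by rewrite lee_fin ler1n. Qed.

(** A product of square-integrable functions is integrable, so the expectations are finite and
    [fine] respects sums and multiples. *)
Lemma inner_linear a (f g h : T -> R) :
  f \in Lfun P 2%:E -> g \in Lfun P 2%:E -> h \in Lfun P 2%:E ->
  inner (a *: f + g) h = a * inner f h + inner g h.
Proof.
move=> f2 g2 h2; rewrite /inner.
have fh := Lfun2_mul_Lfun1 f2 h2; have gh := Lfun2_mul_Lfun1 g2 h2.
have -> : (a *: f + g) \* h = (a \o* (f \* h)) \+ (g \* h).
  apply/funext => o; rewrite /= !fctE mulrDl.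
  by rewrite -[X in X + _]/(a * f o * h o) -mulrA mulrC.
rewrite expectationD// ?Lfun_scale// expectationZl//.
rewrite fineD ?fin_numM ?expectation_fin_num//.
by rewrite fineM ?expectation_fin_num.
Qed.

Lemma Lfun2_sum (I : Type) (s : seq I) (a : I -> R) (f : I -> T -> R) :
  (forall i, f i \in Lfun P 2%:E) ->
  \sum_(i <- s) a i *: f i \in Lfun P 2%:E.
Proof.
move=> f2; have [L0 Lin] := Lfun_submod_closed P ler12.
elim: s => [|i s IH]; first by rewrite big_nil.
by rewrite big_cons; exact: Lin.
Qed.

Lemma inner_sum (I : Type) (s : seq I) (a : I -> R) (f : I -> T -> R) h :
  (forall i, f i \in Lfun P 2%:E) -> h \in Lfun P 2%:E ->
  inner (\sum_(i <- s) a i *: f i) h = \sum_(i <- s) a i * inner (f i) h.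
Proof.
move=> f2 h2; elim: s => [|i s IH].
  rewrite !big_nil /inner.
  rewrite (_ : 0 \* h = cst 0) ?expectation_cst//.
  by apply/funext => o /=; rewrite mul0r.
by rewrite !big_cons inner_linear ?Lfun2_sum// IH.
Qed.

Definition Lfun2_vector {m} (X : T -> 'cV[R]_m) : Prop :=
  forall i, (fun o => X o i 0) \in Lfun P 2%:E.

Lemma mulmx_entry_sum m q (M : 'M[R]_(q, m)) (X : T -> 'cV[R]_m) i :
  (fun o => (M *m X o) i 0) = \sum_k M i k *: (fun o => X o k 0).
Proof. by apply/funext => o; rewrite mxE fct_sumE. Qed.

Lemma addmx_entry m (X Y : T -> 'cV[R]_m) i :
  (fun o => (X o + Y o) i 0)
  = 1 *: (fun o => X o i 0) + (fun o => Y o i 0).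
Proof. by rewrite scale1r; apply/funext => o; rewrite !fctE mxE. Qed.

Lemma Lfun2_vectorM m q (M : 'M[R]_(q, m)) (X : T -> 'cV[R]_m) :
  Lfun2_vector X -> Lfun2_vector (fun o => M *m X o).
Proof. by move=> X2 i; rewrite mulmx_entry_sum Lfun2_sum. Qed.

Lemma Lfun2_vectorD m (X Y : T -> 'cV[R]_m) :
  Lfun2_vector X -> Lfun2_vector Y -> Lfun2_vector (fun o => X o + Y o).
Proof.
move=> X2 Y2 i; have [_ Lin] := Lfun_submod_closed P ler12.
by rewrite addmx_entry; exact: Lin.
Qed.

Lemma cross_momentMl m q r (M : 'M[R]_(q, m)) (X : T -> 'cV[R]_m)
    (Y : T -> 'cV[R]_r) :
  Lfun2_vector X -> Lfun2_vector Y ->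
  cross_moment P (fun o => M *m X o) Y = M *m cross_moment P X Y.
Proof.
move=> X2 Y2; apply/matrixP => i j; rewrite !mxE.
rewrite -[LHS]/(inner (fun o => (M *m X o) i 0) (fun o => Y o j 0)).
rewrite mulmx_entry_sum inner_sum//.
by apply: eq_bigr => k _; rewrite mxE.
Qed.

Lemma cross_momentDl m r (X Z : T -> 'cV[R]_m) (Y : T -> 'cV[R]_r) :
  Lfun2_vector X -> Lfun2_vector Z -> Lfun2_vector Y ->
  cross_moment P (fun o => X o + Z o) Y
  = cross_moment P X Y + cross_moment P Z Y.
Proof.
move=> X2 Z2 Y2; apply/matrixP => i j; rewrite !mxE.
rewrite -[LHS]/(inner (fun o => (X o + Z o) i 0) (fun o => Y o j 0)).
by rewrite addmx_entry inner_linear// mul1r.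
Qed.

Lemma cross_moment_tr m r (X : T -> 'cV[R]_m) (Y : T -> 'cV[R]_r) :
  (cross_moment P X Y)^T = cross_moment P Y X.
Proof.
apply/matrixP => i j; rewrite !mxE; congr (fine (expectation P _)).
by apply/funext => o; rewrite mulrC.
Qed.

Lemma cross_momentMr m q r (M : 'M[R]_(q, r)) (X : T -> 'cV[R]_m)
    (Y : T -> 'cV[R]_r) :
  Lfun2_vector X -> Lfun2_vector Y ->
  cross_moment P X (fun o => M *m Y o) = cross_moment P X Y *m M^T.
Proof.
move=> X2 Y2; rewrite -cross_moment_tr cross_momentMl// trmx_mul.
by rewrite cross_moment_tr.
Qed.

Lemma cross_momentDr m r (X : T -> 'cV[R]_m) (Y Z : T -> 'cV[R]_r) :
  Lfun2_vector X -> Lfun2_vector Y -> Lfun2_vector Z ->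
  cross_moment P X (fun o => Y o + Z o)
  = cross_moment P X Y + cross_moment P X Z.
Proof.
move=> X2 Y2 Z2; rewrite -cross_moment_tr cross_momentDl// linearD/=.
by rewrite !cross_moment_tr.
Qed.

(** Shaped for e_t, w_t and v_{t+1}: the next error and the innovation are both combinations of
    these three, so all covariances of the filter are instances. *)
Lemma cross_moment_bilinear m1 m2 m3 q r
    (X : T -> 'cV[R]_m1) (Y : T -> 'cV[R]_m2) (Z : T -> 'cV[R]_m3)
    (MX : 'M[R]_(q, m1)) (MY : 'M[R]_(q, m2)) (MZ : 'M[R]_(q, m3))
    (NX : 'M[R]_(r, m1)) (NY : 'M[R]_(r, m2)) (NZ : 'M[R]_(r, m3)) :
  Lfun2_vector X -> Lfun2_vector Y -> Lfun2_vector Z ->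
  cross_moment P X Y = 0 -> cross_moment P X Z = 0 -> cross_moment P Y Z = 0 ->
  cross_moment P (fun o => MX *m X o + MY *m Y o + MZ *m Z o)
                 (fun o => NX *m X o + NY *m Y o + NZ *m Z o)
  = MX *m cross_moment P X X *m NX^T + MY *m cross_moment P Y Y *m NY^T
    + MZ *m cross_moment P Z Z *m NZ^T.
Proof.
move=> X2 Y2 Z2 XY XZ YZ.
have YX : cross_moment P Y X = 0 by rewrite -cross_moment_tr XY trmx0.
have ZX : cross_moment P Z X = 0 by rewrite -cross_moment_tr XZ trmx0.
have ZY : cross_moment P Z Y = 0 by rewrite -cross_moment_tr YZ trmx0.
have M2 := Lfun2_vectorM; have D2 := Lfun2_vectorD.
rewrite !(cross_momentDl, cross_momentDr, cross_momentMl, cross_momentMr);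
  try by auto.
by rewrite XY XZ YZ YX ZX ZY !(mul0mx, mulmx0, addr0, add0r) !mulmxA.
Qed.

(** The sets with Borel preimage form a sigma-algebra; it contains the open intervals because
    coordinates are continuous, and these generate. *)
Lemma borel_coord m (i : 'I_m) (B : set R) : measurable B ->
  borel ((fun M : 'cV[R]_m => M i 0) @^-1` B).
Proof.
have sC := smallest_sigma_algebra setT [set U : set 'cV[R]_m | open U].
have [s0 sD sU] := sC.
move=> mB; have {mB} : (@RGenOpens.G R).-sigma.-measurable B.
  by rewrite -RGenOpens.measurableE.
move: B; pose S :=
  [set B : set R | borel ((fun M : 'cV[R]_m => M i 0) @^-1` B)].
suff : <<s @RGenOpens.G R >> `<=` S by [].
apply: smallest_sub.
  split=> [|U SU|F SF].
  - by rewrite /S/= preimage_set0.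
  - by rewrite /S/= setTD preimage_setC -setTD; exact: sD.
  - by rewrite /S/= preimage_bigcup; exact: sU.
move=> _ [x [y ->]]; apply: sub_sigma_algebra => /=.
have /continuousP := @coord_continuous R m 1 i 0; apply.
exact: interval_open.
Qed.

Lemma random_vector_coord m (X : T -> 'cV[R]_m) i :
  random_vector X -> measurable_fun setT (fun o => X o i 0).
Proof. by move=> mX _ B mB; rewrite setTI; exact: mX (borel_coord i mB). Qed.

Lemma random_vector_Lfun2 m (X : T -> 'cV[R]_m) :
  random_vector X -> finite_second_moment P X -> Lfun2_vector X.
Proof.
move=> mX X2 i; have mXi := random_vector_coord i mX.
rewrite inE; apply/andP; split; rewrite inE//=.
rewrite /finite_norm unlock poweR_lty//.
have := X2 i; rewrite unlock; apply: le_lt_trans.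
rewrite le_eqVlt; apply/orP; left; apply/eqP; apply: eq_integral => o _ /=.
by rewrite powR_mulrn// -normrX ger0_norm// sqr_ge0.
Qed.

(** Only Y is centred, so X may be the initial state or estimate, whose mean is arbitrary. *)
Lemma cross_moment_independent m r (X : T -> 'cV[R]_m) (Y : T -> 'cV[R]_r) :
  random_vector X -> random_vector Y -> Lfun2_vector X -> Lfun2_vector Y ->
  (forall A B, borel A -> borel B ->
    P (X @^-1` A `&` Y @^-1` B) = (P (X @^-1` A) * P (Y @^-1` B))%E) ->
  mean P Y = 0 -> cross_moment P X Y = 0.
Proof.
move=> mX mY X2 Y2 XY Y0; apply/matrixP => i j; rewrite !mxE.
pose Xi : {mfun T >-> R} := HB.pack (fun o => X o i 0)
  (isMeasurableFun.Build _ _ _ _ _ (random_vector_coord i mX)).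
pose Yj : {mfun T >-> R} := HB.pack (fun o => Y o j 0)
  (isMeasurableFun.Build _ _ _ _ _ (random_vector_coord j mY)).
have -> : 'E_P[(fun o => X o i 0 * Y o j 0)%R]%E = ('E_P[Xi] * 'E_P[Yj])%E.
  apply: (@expectation_mul_independent _ _ _ P Xi Yj (X2 i) (Y2 j)).
  move=> A B mA mB.
  exact: XY (borel_coord i mA) (borel_coord j mB).
have P1 : P setT \is a fin_num by rewrite probability_setT.
rewrite fineM; last 2 first.
- by rewrite expectation_fin_num//; exact: Lfun_subset12 (X2 i).
- by rewrite expectation_fin_num//; exact: Lfun_subset12 (Y2 j).
have := congr1 (fun M : 'cV[R]_r => M j 0) Y0; rewrite !mxE => ->.
by rewrite mulr0.
Qed.

End moments.

(** * Covariances of the filter *)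

(** For the trace pairing, W |-> W - F^T W F is adjoint to X |-> X - F X F^T. The Gramian equation
    thus converts the change of the loss into the defect of X' as a fixed point for L. *)
Lemma tr_innov_cov_sub (R : realType) (n p : nat) (A : 'M[R]_n)
    (C : 'M[R]_(p, n)) (Qw : 'M[R]_n) (Rv : 'M[R]_p) (L L' : 'M[R]_(n, p))
    (W X X' : 'M[R]_n) :
  W = (closed_loop A C L)^T *m W *m closed_loop A C L
      + (C *m A)^T *m (C *m A) ->
  X = err_step A C Qw Rv L X -> X' = err_step A C Qw Rv L' X' ->
  \tr (innov_cov A C Qw Rv X') - \tr (innov_cov A C Qw Rv X)
  = \tr (W *m (err_step A C Qw Rv L' X' - err_step A C Qw Rv L X')).
Proof.
set F := closed_loop A C L => WE XE XE'.
have -> : err_step A C Qw Rv L' X' - err_step A C Qw Rv L X'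
    = (X' - X) - F *m (X' - X) *m F^T.
  rewrite -XE' {1}XE /err_step /stein -/F mulmxBr mulmxBl.
  move: (F *m X' *m F^T) (F *m X *m F^T) (drive _ _ _ _) => M1 M2 M3.
  by apply/matrixP => i j; rewrite !mxE; ring.
have -> : \tr (innov_cov A C Qw Rv X') - \tr (innov_cov A C Qw Rv X)
    = \tr ((C *m A)^T *m (C *m A) *m (X' - X)).
  rewrite -linearB/= /innov_cov opprD addrACA subrr addr0 -mulmxBl -mulmxBr.
  rewrite opprD addrACA subrr addr0 -mulmxBl -mulmxBr.
  by rewrite !mulmxA -[_ *m A^T *m C^T]mulmxA -trmx_mul mxtrace_mulC !mulmxA.
have -> : (C *m A)^T *m (C *m A) = W - F^T *m W *m F.
  by rewrite [in X in X - _]WE addrC addKr.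
move: (X' - X) => D; rewrite mulmxBl mulmxBr !linearB/=; congr (_ - _).
by rewrite -!mulmxA mxtrace_mulC -!mulmxA.
Qed.

Section kalman.
Context {R : realType} {d : measure_display} {T : measurableType d}
  (P : probability T R) {n p : nat}.
Variables (A : 'M[R]_n) (C : 'M[R]_(p, n)) (Qw : 'M[R]_n) (Rv : 'M[R]_p).
Variables (x0 xhat0 : T -> 'cV[R]_n).
Variables (w : nat -> T -> 'cV[R]_n) (v : nat -> T -> 'cV[R]_p).

Lemma sigma_process_preimage m (X : nat -> T -> 'cV[R]_m) t B :
  borel B -> sigma_process X (X t @^-1` B).
Proof. by move=> mB; apply: sub_sigma_algebra; exists t => //; exists B. Qed.

Lemma noise_Lfun2 m (X : nat -> T -> 'cV[R]_m) Q t :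
  noise P X Q -> Lfun2_vector P (X t).
Proof. by case=> -[mX _ _] X2 _ _; exact: random_vector_Lfun2. Qed.

Lemma noise_uncorrelated m (X : nat -> T -> 'cV[R]_m) Q s t :
  noise P X Q -> s != t -> cross_moment P (X s) (X t) = 0.
Proof.
move=> nX st; case: (nX) => -[mX indX _] _ X0 _.
apply: cross_moment_independent => //; try exact: noise_Lfun2 nX.
move=> B1 B2 mB1 mB2.
(* Mutual independence on a list of two indices; the family of Borel sets is B1 at s and B2 at all
   other indices, in particular at t. *)
have := indX [:: s; t] (fun r => if r == s then B1 else B2).
rewrite /= inE st => /(_ isT); rewrite !big_cons big_nil mule1 eqxx.
rewrite eq_sym (negbTE st) => <-; last by move=> r; case: ifP.
congr (P _); apply/seteqP; split=> o /=.
  move=> [B1o B2o] r /=; rewrite !inE => /orP[]/eqP ->; first by rewrite eqxx.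
  by rewrite eq_sym (negbTE st).
move=> H; split; first by have := H s; rewrite /= inE eqxx; exact.
by have := H t; rewrite /= !inE eqxx orbT eq_sym (negbTE st); exact.
Qed.

Hypotheses (w_noise : noise P w Qw) (v_noise : noise P (fun t => v t.+1) Rv).
Hypothesis wv_indep : independent_algebras P
  (sigma_process w) (sigma_process (fun t => v t.+1)).
Hypotheses (x0_rv : random_vector x0) (xhat0_rv : random_vector xhat0).
Hypotheses (x0_moment : finite_second_moment P x0)
  (xhat0_moment : finite_second_moment P xhat0).
Hypothesis init_indep : independent_algebras P
  <<s sigma_vector x0 `|` sigma_vector xhat0 >>
  <<s sigma_process w `|` sigma_process (fun t => v t.+1) >>.

Let w2 t : Lfun2_vector P (w t) := noise_Lfun2 t w_noise.
Let v2 t : Lfun2_vector P (v t.+1) := noise_Lfun2 t v_noise.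

Lemma process_noise_uncorrelated s t : cross_moment P (w s) (v t.+1) = 0.
Proof.
case: (w_noise) (v_noise) => -[mw _ _] _ _ _ [[mv _ _] _ v0 _].
apply: cross_moment_independent;
  [exact: mw|exact: mv|exact: w2|exact: v2| |exact: v0].
move=> B1 B2 mB1 mB2; apply: wv_indep; first exact: sigma_process_preimage.
exact: (sigma_process_preimage (X := fun t => v t.+1)).
Qed.

Lemma init_uncorrelated m (X : T -> 'cV[R]_n) (Y : T -> 'cV[R]_m) :
  random_vector X -> Lfun2_vector P X -> random_vector Y -> Lfun2_vector P Y ->
  mean P Y = 0 ->
  sigma_vector X `<=` sigma_vector x0 `|` sigma_vector xhat0 ->
  sigma_vector Y `<=` sigma_process w `|` sigma_process (fun t => v t.+1) ->
  cross_moment P X Y = 0.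
Proof.
move=> mX X2 mY Y2 Y0 sX sY.
apply: cross_moment_independent => // B1 B2 mB1 mB2.
by apply: init_indep; apply: sub_sigma_algebra; [apply: sX|apply: sY];
  [exists B1|exists B2].
Qed.

Section gain.
Variable L : 'M[R]_(n, p).
Let e := estimation_error A C x0 xhat0 w v L.
Let delta := innovation_succ A C x0 xhat0 w v L.
Let F := closed_loop A C L.

(** The explicit coefficient - L, like 1 in [innovation_succE], puts the sum in the shape of
    [cross_moment_bilinear]. *)
Lemma estimation_errorS t : e t.+1 =
  fun o => F *m e t o + (1%:M - L *m C) *m w t o + (- L) *m v t.+1 o.
Proof.
apply/funext => o; rewrite /e /estimation_error /= /output /= /F /closed_loop.
move: (state _ _ _ _ _) (estimate _ _ _ _ _ _ _) (w t o) (v _ _) => x y a b.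
rewrite !(mulmxDl, mulmxDr, mulmxBl, mulmxBr, mul1mx, mulmxN, mulNmx) !mulmxA.
move: (A *m x) (A *m y) (L *m C *m A *m x) (L *m C *m A *m y)
  (L *m C *m a) (L *m b).
by move=> M1 M2 M3 M4 M5 M6; apply/matrixP => i j; rewrite !mxE; ring.
Qed.

Lemma innovation_succE t : delta t =
  fun o => (C *m A) *m e t o + C *m w t o + 1%:M *m v t.+1 o.
Proof.
apply/funext => o.
rewrite /delta /innovation_succ /output /= /e /estimation_error.
move: (state _ _ _ _ _) (estimate _ _ _ _ _ _ _) (w t o) (v _ _) => x y a b.
rewrite mul1mx mulmxDr mulmxBr !mulmxA.
by rewrite addrAC [X in X + b = _]addrAC.
Qed.

(** e_t involves only the initial data, w_r with r < t and v_r with r <= t, so w_s and v_{s+1} are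
    fresh for s >= t. Square integrability goes through the same induction, since expanding the
    moments requires it. *)
Lemma estimation_error_uncorrelated t : Lfun2_vector P (e t) /\
  forall s, (t <= s)%N ->
    cross_moment P (e t) (w s) = 0 /\ cross_moment P (e t) (v s.+1) = 0.
Proof.
have M2 := @Lfun2_vectorM _ _ _ P; have D2 := @Lfun2_vectorD _ _ _ P.
have x2 := random_vector_Lfun2 x0_rv x0_moment.
have y2 := random_vector_Lfun2 xhat0_rv xhat0_moment.
case: (w_noise) (v_noise) => -[mw _ _] _ w0 _ [[mv _ _] _ v0 _].
elim: t => [|t [e2 IH]].
  have e0E : e 0%N = fun o => x0 o + (- 1%:M) *m xhat0 o.
    by apply/funext => o; rewrite mulNmx mul1mx.
  rewrite e0E; split; first by apply: D2 => //; exact: M2.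
  have sx : sigma_vector x0 `<=` sigma_vector x0 `|` sigma_vector xhat0 by left.
  have sy : sigma_vector xhat0 `<=` sigma_vector x0 `|` sigma_vector xhat0.
    by right.
  move=> s _; split; rewrite cross_momentDl ?cross_momentMl//; try exact: M2.
  - have sw : sigma_vector (w s)
        `<=` sigma_process w `|` sigma_process (fun t => v t.+1).
      by move=> _ [B mB <-]; left; exact: sigma_process_preimage.
    by rewrite !init_uncorrelated// mulmx0 addr0.
  - have sv : sigma_vector (v s.+1)
        `<=` sigma_process w `|` sigma_process (fun t => v t.+1).
      move=> _ [B mB <-]; right.
      exact: (sigma_process_preimage (X := fun t => v t.+1)).
    by rewrite !init_uncorrelated ?mulmx0 ?addr0//; first [exact: mv|exact: v0].
rewrite estimation_errorS; split.
  by apply: Lfun2_vectorD; [apply: Lfun2_vectorD|]; apply: Lfun2_vectorM.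
move=> s ts; have [ew ev] := IH _ (ltnW ts).
have Mw := M2 _ _ (1%:M - L *m C) _ (w2 t); have Mv := M2 _ _ (- L) _ (v2 t).
have Me := M2 _ _ F _ e2; have Mew := D2 _ _ _ Me Mw.
have st : t != s by rewrite neq_ltn ts.
split; rewrite !cross_momentDl ?cross_momentMl//.
  rewrite ew (noise_uncorrelated w_noise)// -(cross_moment_tr _ (w s)).
  by rewrite process_noise_uncorrelated trmx0 !mulmx0 !addr0.
rewrite ev process_noise_uncorrelated.
by rewrite (noise_uncorrelated (X := fun t => v t.+1) v_noise)// !mulmx0 !addr0.
Qed.

Lemma error_covariances t :
  [/\ cross_moment P (e t.+1) (e t.+1)
        = err_step A C Qw Rv L (cross_moment P (e t) (e t)),
      cross_moment P (delta t) (delta t)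
        = innov_cov A C Qw Rv (cross_moment P (e t) (e t))
    & cross_moment P (e t.+1) (delta t)
        = error_innov_cov A C Qw Rv L (cross_moment P (e t) (e t))].
Proof.
have [e2 /(_ t (leqnn t))[ew ev]] := estimation_error_uncorrelated t.
have wv := process_noise_uncorrelated t t.
have cw : cross_moment P (w t) (w t) = Qw by case: w_noise.
have cv : cross_moment P (v t.+1) (v t.+1) = Rv by case: v_noise.
have bil q r (M1 : 'M[R]_(q, n)) M2 M3 (N1 : 'M[R]_(r, n)) N2 N3 :=
  cross_moment_bilinear M1 M2 M3 N1 N2 N3 e2 (w2 t) (v2 t) ew ev wv.
rewrite estimation_errorS innovation_succE; split; rewrite bil cw cv.
- rewrite /err_step /stein /drive addrA; congr (_ + _).
  by rewrite mulNmx linearN/= mulmxN mulNmx opprK.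
- rewrite /innov_cov mul1mx trmx1 mulmx1 mulmxDr mulmxDl trmx_mul.
  by rewrite !mulmxA.
- rewrite /error_innov_cov trmx1 mulmx1 mulNmx /F /closed_loop trmx_mul.
  by set B := 1%:M - L *m C; rewrite mulmxDr mulmxDl !mulmxA.
Qed.

Lemma error_covariance_iter t : cross_moment P (e t) (e t)
  = iter t (err_step A C Qw Rv L) (cross_moment P (e 0%N) (e 0%N)).
Proof.
by elim: t => // t IH; rewrite iterS -IH; case: (error_covariances t).
Qed.

(** A total function of the gain, shown to be a genuine limit where the powers of the closed loop
    tend to 0. *)
Definition err_cov : 'M[R]_n :=
  lim ((fun t => cross_moment P (e t) (e t)) @ \oo).

Hypothesis F0 : (fun t => F ^+ t : 'M[R]_n) @ \oo --> (0 : 'M[R]_n).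

(** The covariances are iterates of an affine map whose orbits all tend to its fixed point, whatever
    the initial covariance. *)
Lemma err_cov_cvg : (fun t => cross_moment P (e t) (e t)) @ \oo --> err_cov
  /\ err_cov = err_step A C Qw Rv L err_cov.
Proof.
have [X XE] := stein_exists (drive C Qw Rv L) F0.
have cX : (fun t => cross_moment P (e t) (e t)) @ \oo --> X.
  under eq_fun do rewrite error_covariance_iter.
  exact: iter_stein_cvg F0 XE.
have -> : err_cov = X by apply: cvg_lim.
by split.
Qed.

Lemma Sigma_deltaE :
  Sigma_delta P A C x0 xhat0 w v L = innov_cov A C Qw Rv err_cov.
Proof.
apply: cvg_lim => //.
under eq_fun => t do (have [_ -> _] := error_covariances t).
by apply: cvg_innov_cov; have [] := err_cov_cvg.
Qed.

Lemma K_innovE :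
  K_innov P A C x0 xhat0 w v L = error_innov_cov A C Qw Rv L err_cov.
Proof.
apply: cvg_lim => //.
under eq_fun => t do (have [_ _ ->] := error_covariances t).
by apply: cvg_error_innov_cov; have [] := err_cov_cvg.
Qed.

End gain.
End kalman.

(** * The gradient of the innovations loss *)

Theorem theorem3p1 (R : realType) (d : measure_display) (T : measurableType d)
    (P : probability T R) (n p : nat)
    (A : 'M[R]_n) (C : 'M[R]_(p, n)) (Qw : 'M[R]_n) (Rv : 'M[R]_p)
    (x0 xhat0 : T -> 'cV[R]_n)
    (w : nat -> T -> 'cV[R]_n) (v : nat -> T -> 'cV[R]_p)
    (Qw_posdef : posdefmx Qw) (Rv_posdef : posdefmx Rv)
    (w_noise : noise P w Qw)
    (v_noise : noise P (fun t => v t.+1) Rv)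
    (wv_indep : independent_algebras P
       (sigma_process w) (sigma_process (fun t => v t.+1)))
    (x0_rv : random_vector x0) (xhat0_rv : random_vector xhat0)
    (x0_moment : finite_second_moment P x0)
    (xhat0_moment : finite_second_moment P xhat0)
    (init_indep : independent_algebras P
       <<s sigma_vector x0 `|` sigma_vector xhat0 >>
       <<s sigma_process w `|` sigma_process (fun t => v t.+1) >>)
    (L : 'M[R]_(n, p)) (L_stab : stabilizing A C L) :
  is_gradient (J_innov P A C x0 xhat0 w v) L
    (- 2 *: (observability_gramian (closed_loop A C L) (C *m A)
             *m K_innov P A C x0 xhat0 w v L)).
Proof.
have QT : Qw^T = Qw by case: Qw_posdef.
have VT : Rv^T = Rv by case: Rv_posdef.
have F0 := spectral_radius_lt1_cvg0 L_stab.
have [WT WE] := observability_gramian_stein (C *m A) F0.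
set W := observability_gramian _ _ in WT WE *.
pose S := err_cov P A C x0 xhat0 w v.
have nearF := near_closed_loop_cvg0 F0.
(* Stated for every gain whose closed-loop powers vanish, hence usable throughout the neighbourhood
   of L given by [nearF]. *)
have SE L' :
    (fun t => closed_loop A C L' ^+ t : 'M[R]_n) @ \oo --> (0 : 'M[R]_n) ->
    S L' = err_step A C Qw Rv L' (S L').
  by move=> /(err_cov_cvg w_noise v_noise wv_indep x0_rv xhat0_rv
    x0_moment xhat0_moment init_indep)[].
have JE L' :
    (fun t => closed_loop A C L' ^+ t : 'M[R]_n) @ \oo --> (0 : 'M[R]_n) ->
    J_innov P A C x0 xhat0 w v L' = \tr (innov_cov A C Qw Rv (S L')).
  by rewrite /J_innov => /(Sigma_deltaE w_noise v_noise wv_indep x0_rv xhat0_rv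
    x0_moment xhat0_moment init_indep) ->.
have Scvg : S x @[x --> L] --> S L.
  exact: (cvg_err_cov F0 (filterS SE nearF)).
rewrite (K_innovE w_noise v_noise wv_indep x0_rv xhat0_rv x0_moment
  xhat0_moment init_indep F0) -/(S L).
(* The exact factor of the increment: the cross covariance keeps the gain L, while the error
   covariance is that of L'. *)
pose E L' := - 2 *: (W *m error_innov_cov A C Qw Rv L (S L'))
  + W *m (L' - L) *m innov_cov A C Qw Rv (S L').
apply: (is_gradient_increment (E := E)).
  apply: filterS nearF => L' F0'.
  rewrite !JE// (tr_innov_cov_sub WE (SE _ F0) (SE _ F0')).
  have ST := trmx_err_step_fix QT VT F0' (SE _ F0').
  by have := tr_gramian_increment A C L (L' - L) QT VT ST WT; rewrite subrKC.
have cW : (fun=> W) @ nbhs L --> W by exact: cvg_cst.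
have cD : (fun L' => L' - L) @ nbhs L --> (0 : 'M[R]_(n, p)).
  by rewrite -(subrr L); apply: cvgB; [exact: cvg_id|exact: cvg_cst].
(* The zero summand is the limit of the quadratic term, so that the target matches the limit of E
   term by term. *)
have -> : - 2 *: (W *m error_innov_cov A C Qw Rv L (S L))
    = - 2 *: (W *m error_innov_cov A C Qw Rv L (S L))
      + W *m 0 *m innov_cov A C Qw Rv (S L).
  by rewrite mulmx0 mul0mx addr0.
have FL : Filter (nbhs L) := nbhs_filter L.
have cM := cvg_mulmx (FF := FL) cW (cvg_error_innov_cov (FF := FL) (A := A)
  (C := C) (Qw := Qw) (Rv := Rv) (L := L) Scvg).
have cN := cvg_mulmx (FF := FL) (cvg_mulmx (FF := FL) cW cD)
  (cvg_innov_cov (FF := FL) (A := A) (C := C) (Qw := Qw) (Rv := Rv) Scvg).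
exact: cvgD (cvgZl_tmp (k := - 2) cM) cN.
Qed.
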